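(* Let $G$ be an arbitrary group and let $\mathcal{A} = \langle S, \mathcal{N}, f\rangle$ be a cellular automaton on the full shift $S^G$. If $\mathcal{A}$ is pre-injective and post-surjective, then $\mathcal{A}$ is reversible.
   Context: Let $G$ be a group. A cellular automaton on $G$ (on the full shift $S^G$) is a triple $\mathcal{A} = \langle S, \mathcal{N}, f\rangle$ where $S$ is a finite set with at least two elements, $\mathcal{N}$ is a finite subset of $G$ (the neighborhood), and $f : S^{\mathcal{N}} \to S$ is a function (the local rule). Elements of $S^G$ are called configurations. The global transition function $F : S^G \to S^G$ of $\mathcal{A}$ is defined by: $F(c)(g)$ is the value of $f$ on the function $\mathcal{N} \to S$, $n \mapsto c(gn)$, for every $g \in G$. Two configurations $c, c' \in S^G$ are asymptotic if $\{g \in G : c(g) \neq c'(g)\}$ is finite. $\mathcal{A}$ is pre-injective if any two asymptotic configurations $c, e$ with $F(c) = F(e)$ are equal. $\mathcal{A}$ is post-surjective if for every $e \in S^G$, with $c = F(e)$, and every $c' \in S^G$ asymptotic to $c$, there exists $e' \in S^G$ asymptotic to $e$ with $F(e') = c'$. $\mathcal{A}$ is reversible if $F$ is bijective and $F^{-1}$ is the global transition function of some cellular automaton on $G$ with state set $S$ (the latter condition is automatic when $F$ is bijective). *)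

(* Defs.v *)
From mathcomp Require Import all_boot finmap.
From mathcomp Require Import boolp classical_sets cardinality.

Set Implicit Arguments.
Unset Strict Implicit.
Unset Printing Implicit Defensive.

Local Open Scope classical_set_scope.
Local Open Scope group_scope.

(* A groupType is an arbitrary, possibly infinite, group on a choiceType; the
   latter is no restriction, as boolp equips every type with a choice operator.
   The requirement that S has at least two elements is not part of the record:
   it is left as a hypothesis [1 < #|S|] on the state set. *)
Record cellular_automaton (G : groupType) (S : finType) := CellularAutomaton {
  neighborhood : {fset G};
  local_rule : {ffun neighborhood -> S} -> S }.

Definition global_transition (G : groupType) (S : finType)
    (A : cellular_automaton G S) (c : G -> S) : G -> S :=
  fun g => local_rule [ffun n : neighborhood A => c (g * val n)].

Definition asymptotic (G : groupType) (S : finType) (c c' : G -> S) : Prop :=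
  finite_set [set g | c g <> c' g].

Definition pre_injective (G : groupType) (S : finType)
    (A : cellular_automaton G S) : Prop :=
  forall c e : G -> S, asymptotic c e ->
    global_transition A c = global_transition A e -> c = e.

Definition post_surjective (G : groupType) (S : finType)
    (A : cellular_automaton G S) : Prop :=
  forall e c' : G -> S, asymptotic c' (global_transition A e) ->
    exists2 e' : G -> S, asymptotic e' e & global_transition A e' = c'.

Definition reversible (G : groupType) (S : finType)
    (A : cellular_automaton G S) : Prop :=
  bijective (global_transition A) /\
  exists B : cellular_automaton G S,
    cancel (global_transition A) (global_transition B) /\
    cancel (global_transition B) (global_transition A).

(* Main.v *)
Require Import Defs.
From mathcomp Require Import all_boot.
From mathcomp Require Import finmap.
From mathcomp Require Import boolp classical_sets cardinality filter.

(** The inverse of [F] is a cellular automaton as soon as [x g] can be read off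
    from [F x] on a finite window around [g], of a shape independent of [x] and
    [g].  Between asymptotic configurations, such a window comes from playing the
    two hypotheses against each other.

    Post-surjectivity says that a change of [F e] at one site can be realised by
    a finite change of [e]; by compactness of the full shift, the sites to be
    changed stay in one finite set [M], the same for all [e]
    ([post_surjective_uniform]).  Correcting the sites of a finite set [K] one
    after the other, every change of [F e] on [K] is realised by a change of [e]
    on [K * M] ([post_surjective_local]).  Now let [x] and [x'] be asymptotic
    with [F x] and [F x'] equal on [g * M^-1], and let [K] be the set of sites
    where [F x] and [F x'] differ.  Some [x''] which differs from [x] only on
    [K * M] has [F x'' = F x'], so [x'' = x'] by pre-injectivity; and [g] is not
    in [K * M], whence [x g = x' g] ([pre_injective_local_inverse]).

    Fix a configuration [e0].  A pattern on the window [M^-1], completed by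
    [F e0], has a preimage asymptotic to [e0] by post-surjectivity; the value of
    that preimage at [1] is taken as the local rule of an automaton [B].  Then
    [B (F x) = x] for all [x]: translate the site of interest to [1] and replace
    [x] by [e0] far away, so that the preimage chosen by [B] and [x] become
    asymptotic.  Finally [F (B y) = y]: on a window large enough to determine
    both sides at a given site, [y] coincides with a configuration asymptotic to
    [F e0], which has the form [F x], and [F (B (F x)) = F x]. *)

Set Implicit Arguments.
Unset Strict Implicit.
Unset Printing Implicit Defensive.

(** * Compactness of the full shift *)

(** Compactness of [S^I], with finite sets as the directed set indexing the net
    [x]: the limit [e] is the pointwise limit of [x] along an ultrafilter that
    contains all the cones of finite sets above a given one. *)
Lemma full_shift_cluster_point (I : choiceType) (S : finType)
    (x : {fset I} -> I -> S) :
  exists e : I -> S, forall M W : {fset I},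
    exists2 M' : {fset I}, (M `<=` M')%fset & forall i, i \in W -> x M' i = e i.
Proof.
pose cones (X : set {fset I}) :=
  exists M : {fset I}, forall M' : {fset I}, (M `<=` M')%fset -> X M'.
have cones_proper : ProperFilter cones.
  split; first by move=> [M /(_ M (fsubset_refl M))].
  split; first by exists fset0.
    move=> X Y [M hM] [N hN]; exists (M `|` N)%fset => M'.
    by rewrite fsubUset => /andP[/hM ? /hN ?].
  by move=> X Y sXY [M hM]; exists M => M' /hM /sXY.
have [U [ultraU sU]] := ultraFilterLemma cones_proper.
have [|e he] := @choice I S (fun i s => U (fun M => x M i = s)).
  move=> i; apply: contrapT => /forallNP h.
  (* otherwise [U] contains the set of [M] with [x M i] distinct from every
     element of [S], which is empty *)
  have : U (fun M => forall s, x M i <> s).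
    apply: filter_forall => s.
    have [/h //|//] := in_ultra_setVsetC (fun M => x M i = s) ultraU.
  by case/filter_ex => M /(_ (x M i)).
exists e => M W.
have UM : U (fun M' => (M `<=` M')%fset) by apply: sU; exists M.
have UW := filter_bigI (D := W) (f := fun i M' => x M' i = e i) _
  (fun i _ => he i).
by have [M' [MM' WM']] := filter_ex (filterI UM (UW _)); exists M'.
Qed.

(** * Finite windows *)

Definition fset_mul (G : groupType) (A B : {fset G}) : {fset G} :=
  [fset (a * b)%g | a in A, b in B]%fset.

Lemma mem_fset_mul (G : groupType) (A B : {fset G}) (a b : G) :
  a \in A -> b \in B -> (a * b)%g \in fset_mul A B.
Proof. by move=> aA bB; apply: (in_imfset2 _ (fun a b : G => (a * b)%g)). Qed.

Definition splice (G : groupType) (S : finType) (W : {fset G}) (x y : G -> S) :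
  G -> S := fun g => if g \in W then x g else y g.

Lemma splice_in (G : groupType) (S : finType) (W : {fset G}) (x y : G -> S) g :
  g \in W -> splice W x y g = x g.
Proof. by rewrite /splice => ->. Qed.

Lemma splice_out (G : groupType) (S : finType) (W : {fset G}) (x y : G -> S) g :
  g \notin W -> splice W x y g = y g.
Proof. by rewrite /splice => /negbTE ->. Qed.

Lemma asymptoticP (G : groupType) (S : finType) (c c' : G -> S) :
  asymptotic c c' <->
  exists D : {fset G}, forall g, g \notin D -> c g = c' g.
Proof.
split=> [/finite_fsetP[D eqD]|[D eqD]].
  exists D => g gD; apply: contrapT => neq.
  have : [set` D]%classic g by rewrite -eqD.
  by rewrite /= (negbTE gD).
apply/(sub_finite_set _ (finite_fset D)) => g /= neq.
by apply: contrapT => /negP /eqD.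
Qed.

Lemma asymptotic_sym (G : groupType) (S : finType) (c c' : G -> S) :
  asymptotic c c' -> asymptotic c' c.
Proof. by case/asymptoticP => D h; apply/asymptoticP; exists D => g /h. Qed.

Lemma asymptotic_trans (G : groupType) (S : finType) (b a c : G -> S) :
  asymptotic a b -> asymptotic b c -> asymptotic a c.
Proof.
case/asymptoticP => D h /asymptoticP[E k]; apply/asymptoticP.
exists (D `|` E)%fset => g; rewrite in_fsetU negb_or => /andP[/h -> /k //].
Qed.

Lemma asymptotic_splice (G : groupType) (S : finType) (W : {fset G})
  (x y : G -> S) : asymptotic (splice W x y) y.
Proof. by apply/asymptoticP; exists W => g; apply: splice_out. Qed.

Definition shift (G : groupType) (S : finType) (k : G) (c : G -> S) : G -> S :=
  fun g => c (k * g)%g.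

Section GlobalTransition.
Context {G : groupType} {S : finType} (A : cellular_automaton G S).
Local Notation F := (global_transition A).
Local Notation N := (neighborhood A).

Lemma eq_global_transition (c c' : G -> S) (g : G) :
  (forall n, n \in N -> c (g * n)%g = c' (g * n)%g) -> F c g = F c' g.
Proof.
move=> h; rewrite /global_transition; congr local_rule.
by apply/ffunP => n; rewrite !ffunE h ?fsvalP.
Qed.

Lemma global_transition_shift (k : G) (c : G -> S) :
  F (shift k c) = shift k (F c).
Proof.
apply/funext => g; rewrite /shift /global_transition; congr local_rule.
by apply/ffunP => n; rewrite !ffunE mulgA.
Qed.

Lemma global_transition_asymptotic (c c' : G -> S) :
  asymptotic c c' -> asymptotic (F c) (F c').
Proof.
case/asymptoticP => D h; apply/asymptoticP.
exists (fset_mul D [fset n^-1%g | n in N]%fset) => g gDN.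
apply: eq_global_transition => n nN; apply: h; apply: contraNN gDN => gnD.
by rewrite -(mulgK n g) mem_fset_mul // in_imfset.
Qed.

(** * Uniform post-surjectivity *)

(** For a fixed [e], post-surjectivity provides a finite [M].  If no [M] served
    all [e], a cluster point of counterexamples would be a counterexample for
    every [M], because whether a change of [e] on a finite set has the prescribed
    effect on [F e] depends on [e] in a finite window only. *)
Lemma post_surjective_uniform (s : S) : post_surjective A ->
  exists M : {fset G}, forall e, exists2 e' : G -> S,
    forall g, g \notin M -> e' g = e g
    & F e' = splice [fset 1%g]%fset (fun=> s) (F e).
Proof.
move=> hpost; apply: contrapT => /forallNP noM.
have [x hx] := choice (fun M => (existsNP _).2 (noM M)).
have [e he] := full_shift_cluster_point x.
have [e' /asymptoticP[D eqD] Fe'] :=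
  hpost e _ (asymptotic_splice [fset 1%g]%fset (fun=> s) (F e)).
(* the sites whose image may be affected by a change on [D], and [1] itself *)
pose T := (1%g |` fset_mul D [fset n^-1%g | n in N])%fset.
have [M DM eqW] := he D (fset_mul T N).
apply: (hx M); exists (splice D e' (x M)).
  by move=> g gM; apply: splice_out; apply: contraNN gM; apply: (fsubsetP DM).
apply/funext => g; have [gT|] := boolP (g \in T).
  have -> : F (splice D e' (x M)) g = F e' g.
    apply: eq_global_transition => n nN; rewrite /splice.
    by case: ifPn => // /eqD ->; apply: eqW; apply: mem_fset_mul.
  rewrite Fe' /splice; case: ifP => // _.
  by apply: eq_global_transition => n nN; rewrite eqW ?mem_fset_mul.
rewrite in_fsetU in_fset1 negb_or => /andP[g1 gD].
rewrite splice_out ?in_fset1 //; apply: eq_global_transition => n nN.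
apply: splice_out; apply: contraNN gD => gnD.
by rewrite -(mulgK n g) mem_fset_mul // in_imfset.
Qed.

(** Sites are corrected one at a time, each after translation to [1].  A
    correction changes the image at that site alone, so it leaves the sites
    already treated intact, and the changes of [e] accumulate in [K * M]. *)
Lemma post_surjective_local : post_surjective A ->
  exists M : {fset G}, forall (K : seq G) (e y : G -> S),
    (forall g, g \notin K -> y g = F e g) ->
    exists2 e' : G -> S,
      forall g, (forall k, k \in K -> (k^-1 * g)%g \notin M) -> e' g = e g
      & F e' = y.
Proof.
move=> hpost.
have [M hM] := choice (fun s => post_surjective_uniform s hpost).
exists (\bigcup_(s <- enum S) M s)%fset; elim=> [|k K IH] e y eqy.
  by exists e => //; apply/funext => g; rewrite eqy.
have [e1 e1M Fe1] := hM (y k) (shift k e).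
have Fe1k g : F (shift k^-1%g e1) g = if g == k then y g else F e g.
  rewrite global_transition_shift /shift Fe1 global_transition_shift.
  rewrite /splice /shift in_fset1 mulVKg -(can_eq (mulKg k) _ 1%g) mulVKg mulg1.
  by case: eqP => [->|].
have [|e' e'M <-] := IH (shift k^-1%g e1) y.
  move=> g gK; rewrite Fe1k; case: eqP => [//|/eqP gk].
  by rewrite eqy // in_cons negb_or gk.
exists e' => // g gM; rewrite e'M => [|j jK]; last first.
  by apply: gM; rewrite in_cons jK orbT.
rewrite /shift e1M ?/shift ?mulVKg //.
apply: contraNN (gM k (mem_head k K)); apply/fsubsetP.
by apply: bigfcup_sup; rewrite ?mem_enum.
Qed.

(** * Locality of the inverse *)

(** The idea: [x'] is the only configuration asymptotic to [x] with its image, so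
    it is the one obtained by correcting [x] near the sites where the images
    differ; these are too far from [g] to affect it. *)
Lemma pre_injective_local_inverse : pre_injective A -> post_surjective A ->
  exists V : {fset G}, forall (x x' : G -> S) (g : G), asymptotic x x' ->
    (forall v, v \in V -> F x (g * v)%g = F x' (g * v)%g) -> x g = x' g.
Proof.
move=> hpre /post_surjective_local[M hM].
exists [fset m^-1%g | m in M]%fset => x x' g xx' eqV.
have /asymptoticP[D eqD] := global_transition_asymptotic xx'.
(* [D] may contain sites where the images agree; these must be discarded for
   [g] to lie outside [K * M] *)
pose K := [seq k <- D | F x k != F x' k].
have [|x'' x''K Fx''] := hM K x (F x').
  move=> k; rewrite mem_filter negb_and negbK => /orP[/eqP //|kD].
  by rewrite eqD.
have <- : x'' = x'.
  apply: hpre Fx''; apply: asymptotic_trans xx'; apply/asymptoticP.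
  exists (fset_mul D M) => h hDM; apply: x''K => k.
  rewrite mem_filter => /andP[_ kD]; apply: contraNN hDM => kM.
  by rewrite -(mulVKg k h) mem_fset_mul.
rewrite x''K // => k; rewrite mem_filter => /andP[neq _].
apply: contraNN neq => kM; apply/eqP.
have := eqV _ (in_imfset _ (fun m : G => m^-1%g) kM).
by rewrite /= invgM invgK mulVKg.
Qed.

(** The state [s0] is only there to provide a reference configuration [e0]: the
    local rule of the inverse reads off a chosen preimage asymptotic to [e0], and
    by the previous lemma the choice has no effect on its value at [1]. *)
Lemma reversible_of_state (s0 : S) :
  pre_injective A -> post_surjective A -> reversible A.
Proof.
move=> hpre hpost; have [V hV] := pre_injective_local_inverse hpre hpost.
pose e0 : G -> S := fun=> s0.
pose fill (p : {ffun V -> S}) : G -> S := fun g =>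
  if insub g is Some v then p v else F e0 g.
have fillE p (v : V) : fill p (val v) = p v by rewrite /fill valK.
have fill_asymptotic p : asymptotic (fill p) (F e0).
  by apply/asymptoticP; exists V => g gV; rewrite /fill insubN.
have preimage p : exists x, asymptotic x e0 /\ F x = fill p.
  by have [x xe0 Fx] := hpost e0 _ (fill_asymptotic p); exists x.
have [X hX] := choice preimage.
pose B := CellularAutomaton (fun p => X p 1%g).
have BA : cancel F (global_transition B).
  move=> x; apply/funext => g; rewrite [LHS]/=.
  set p : {ffun V -> S} := [ffun v => _].
  have [Xpe0 FXp] := hX p.
  (* [x], translated to bring [g] to [1], and made asymptotic to [e0] without
     altering its image on [V] *)
  pose x' := splice (1%g |` fset_mul V N)%fset (shift g x) e0.
  have -> : x g = x' 1%g by rewrite /x' splice_in ?fset1U1 // /shift mulg1.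
  apply: hV.
    by apply: (asymptotic_trans Xpe0); apply/asymptotic_sym/asymptotic_splice.
  move=> v vV; rewrite mul1g FXp -[v]/(val [` vV]%fset) fillE ffunE /=.
  rewrite -[LHS]/(shift g (F x) v) -global_transition_shift.
  apply: eq_global_transition => n nN.
  by rewrite /x' splice_in // in_fsetU mem_fset_mul ?orbT.
have AB : cancel (global_transition B) F.
  move=> y; apply/funext => g.
  pose W := (g |` [fset (g * u)%g | u in fset_mul N V])%fset.
  pose z := splice W y (F e0).
  have [x _ Fx] := hpost e0 z (asymptotic_splice W y (F e0)).
  have zg : y g = F (global_transition B z) g.
    by rewrite -Fx BA Fx /z splice_in ?fset1U1.
  rewrite zg; apply: eq_global_transition => n nN.
  rewrite /global_transition; congr local_rule; apply/ffunP => v.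
  rewrite !ffunE /z splice_in // in_fsetU -mulgA.
  by rewrite (in_imfset _ (fun u : G => g * u)%g) ?orbT //= mem_fset_mul ?fsvalP.
by split; [exists (global_transition B) | exists B].
Qed.

End GlobalTransition.

Theorem theorem1 (G : groupType) (S : finType) (hS : 1 < #|S|)
    (A : cellular_automaton G S)
    (hpre : pre_injective A) (hpost : post_surjective A) :
  reversible A.
Proof.
by have /card_gt0P[s0 _] := ltnW hS; apply: (reversible_of_state s0).
Qed.
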